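(* Let $n\geq 1$ and $k\geq 1$ be integers, let $r\in\mathbb{C}$, and let $C_r^{(k)}=\mathrm{Circ}_r(\mathbb{F}_0^{(k)},\mathbb{F}_1^{(k)},\ldots,\mathbb{F}_{n-1}^{(k)})$ be the $n\times n$ $r$-circulant matrix with first row $(\mathbb{F}_0^{(k)},\ldots,\mathbb{F}_{n-1}^{(k)})$. (i) If $|r|\geq 1$, then \[ \frac{1}{\sqrt{n}}\mathbb{F}_{n-1}^{(k+1)}\leq \|C_r^{(k)}\|_2\leq |r|\sqrt{n-1}\,\mathbb{F}_{n-1}^{(k+1)}. \] (ii) If $|r|<1$, then \[ \frac{|r|}{\sqrt{n}}\mathbb{F}_{n-1}^{(k+1)}\leq \|C_r^{(k)}\|_2\leq \sqrt{n-1}\,\mathbb{F}_{n-1}^{(k+1)}. \]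
   Context: $F_n$ denotes the Fibonacci numbers: $F_0=0$, $F_1=1$, $F_{n+1}=F_n+F_{n-1}$. Hyperharmonic Fibonacci numbers: $\mathbb{F}_n^{(0)}=\frac{1}{F_n}$ for $n\geq1$, and for $m\geq 1$, $\mathbb{F}_n^{(m)}=\sum_{j=1}^{n}\mathbb{F}_j^{(m-1)}$ for $n\ge1$, with $\mathbb{F}_0^{(m)}=0$. For $c_0,\ldots,c_{n-1}\in\mathbb{C}$ and $r\in\mathbb{C}$, the $r$-circulant matrix $\mathrm{Circ}_r(c_0,\ldots,c_{n-1})$ is the $n\times n$ matrix whose $(i,j)$ entry ($0\le i,j\le n-1$) is $c_{j-i}$ if $j\geq i$ and $r\,c_{n+j-i}$ if $j<i$. The spectral norm is $\|A\|_2=\sqrt{\max_i\lambda_i(A^HA)}$, where $A^H$ is the conjugate transpose. *)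

(* Defs.v *)
From mathcomp Require Import all_boot all_order all_algebra.
From mathcomp Require Import spectral complex reals.

Set Implicit Arguments.
Unset Strict Implicit.
Unset Printing Implicit Defensive.

Import Order.TTheory GRing.Theory Num.Theory.
Local Open Scope ring_scope.
Local Open Scope sesquilinear_scope.
Local Open Scope complex_scope.

Fixpoint fib (n : nat) : nat :=
  if n is n'.+1 then
    (if n' is n''.+1 then fib n' + fib n'' else 1)%N
  else 0%N.

(* At m = 0, n = 0 (never reached for m >= 1) the value is 0^-1 = 0. *)
Fixpoint hyperfib (R : realType) (m n : nat) : R :=
  if m is m'.+1 then \sum_(1 <= j < n.+1) hyperfib R m' j
  else ((fib n)%:R)^-1.

Definition circ (R : realType) (n : nat) (r : R[i]) (c : nat -> R[i])
    : 'M[R[i]]_n :=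
  \matrix_(i < n, j < n)
    if (i <= j)%N then c (j - i)%N else r * c (n + j - i)%N.

(* The eigenvalues, listed with algebraic multiplicity: the roots of the
   characteristic polynomial. *)
Definition eigenvalues (R : realType) (n : nat) (A : 'M[R[i]]_n) : seq R[i] :=
  sval (closed_field_poly_normal (char_poly A)).

(* The eigenvalues of A^H A are real and nonnegative, so taking real parts and
   starting the maximum at 0 changes nothing. *)
Definition spectral_norm (R : realType) (n : nat) (A : 'M[R[i]]_n) : R :=
  Num.sqrt (\big[Num.max/0]_(l <- eigenvalues (A ^t* *m A)) complex.Re l).

(* Main.v *)
Require Import Defs.
From mathcomp Require Import all_boot all_order all_algebra.
From mathcomp Require Import complex reals.
From mathcomp Require Import ring lra.
Import Order.TTheory GRing.Theory Num.Theory.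
Local Open Scope ring_scope.
Local Open Scope complex_scope.

(** Write [S] for the sum of the first row [c]. Upper bound: every eigenvalue of
    [A^H A] is at most the product of the largest absolute row sum and the
    largest absolute column sum of [A]; for the [r]-circulant matrix both are at
    most [max(1, |r|) S]. Lower bound: the largest eigenvalue of [A^H A] is at
    least their mean [tr(A^H A) / n], and [tr(A^H A)] is the sum of the squared
    moduli of the entries, which is at least [n min(1, |r|)^2] times the sum of
    the [c_h^2], hence at least [min(1, |r|)^2 S^2] by Cauchy-Schwarz. *)

Local Notation normc := ComplexField.Normc.normc.
Local Notation "M ^t*" := (map_mx Num.conj (trmx M)).

(** Cauchy-Schwarz against the all-ones vector: both sides become double sums over [i], [j],
    compared termwise by [2 * f i * f j <= f i ^+ 2 + f j ^+ 2]. *)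
Lemma sqr_sum_le (R : realFieldType) (n : nat) (f : 'I_n -> R) :
  (\sum_i f i) ^+ 2 <= n%:R * \sum_i f i ^+ 2.
Proof.
have -> : n%:R * \sum_i f i ^+ 2
    = \sum_i \sum_j (f i ^+ 2 + f j ^+ 2) / 2.
  transitivity (\sum_i (n%:R * f i ^+ 2 + \sum_j f j ^+ 2) / 2); last first.
    apply: eq_bigr => i _; rewrite -mulr_suml big_split /= sumr_const card_ord.
    by rewrite mulr_natl.
  rewrite -mulr_suml big_split /= sumr_const card_ord -mulr_sumr -mulr_natl.
  by field.
rewrite expr2 mulr_suml; apply: ler_sum => i _.
rewrite mulr_sumr; apply: ler_sum => j _.
by have := sqr_ge0 (f i - f j); nra.
Qed.

Lemma l1_norm_mulmx_le (K : numDomainType) (m n : nat)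
    (v : 'rV[K]_m) (A : 'M[K]_(m, n)) (M : K) :
  (forall i, \sum_j `|A i j| <= M) ->
  \sum_j `|(v *m A) 0 j| <= M * \sum_i `|v 0 i|.
Proof.
move=> rowA.
apply: (@le_trans _ _ (\sum_j \sum_i `|v 0 i| * `|A i j|)).
  apply: ler_sum => j _; rewrite mxE; apply: le_trans (ler_norm_sum _ _ _) _.
  by apply: ler_sum => i _; rewrite normrM.
rewrite exchange_big mulr_sumr /=; apply: ler_sum => i _.
by rewrite -mulr_sumr mulrC ler_wpM2r.
Qed.

(** For a left eigenvector [v], compare l1 norms: right multiplication by [A ^t*] costs a column sum
    of [A], the one by [A] a row sum. The nonzero norm of [v] then cancels. *)
Lemma norm_eigenvalue_le (K : numClosedFieldType) (n : nat) (A : 'M[K]_n)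
    (l M : K) :
  0 <= M -> (forall i, \sum_j `|A i j| <= M) ->
  (forall j, \sum_i `|A i j| <= M) ->
  eigenvalue (A ^t* *m A) l -> `|l| <= M ^+ 2.
Proof.
move=> M0 rowA colA /eigenvalueP[v vA v0].
have v_gt0 : 0 < \sum_i `|v 0 i|.
  rewrite lt_def sumr_ge0 ?andbT //; apply: contra v0 => /eqP v_eq0.
  apply/eqP/rowP => i; rewrite mxE; apply/normr0_eq0.
  by apply: (psumr_eq0P _ v_eq0) => // j _.
rewrite -(ler_pM2r v_gt0).
have -> : `|l| * \sum_i `|v 0 i| = \sum_i `|(v *m A ^t* *m A) 0 i|.
  rewrite mulr_sumr; apply: eq_bigr => i _.
  by rewrite -mulmxA vA mxE normrM.
apply: le_trans (l1_norm_mulmx_le _ _ _ _ _ _ rowA) _.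
rewrite expr2 -mulrA ler_wpM2l // l1_norm_mulmx_le // => j.
by under eq_bigr => i _ do rewrite !mxE norm_conjC.
Qed.

Section SpectralNorm.
Variable R : realType.

Lemma char_poly_eigenvalues (n : nat) (A : 'M[R[i]]_n) :
  char_poly A = \prod_(l <- eigenvalues A) ('X - l%:P).
Proof.
rewrite /eigenvalues; case: closed_field_poly_normal => s /= ->.
by rewrite (monicP (char_poly_monic A)) scale1r.
Qed.

Lemma mem_eigenvalues (n : nat) (A : 'M[R[i]]_n) (l : R[i]) :
  (l \in eigenvalues A) = eigenvalue A l.
Proof.
by rewrite eigenvalue_root_char char_poly_eigenvalues root_prod_XsubC.
Qed.

Lemma size_eigenvalues (n : nat) (A : 'M[R[i]]_n) : size (eigenvalues A) = n.
Proof.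
by have := size_char_poly A; rewrite char_poly_eigenvalues size_prod_XsubC => -[].
Qed.

(** Up to sign, both sides are the subleading coefficient of the characteristic polynomial. Size 0
    has no such coefficient and is treated apart. *)
Lemma sum_eigenvalues (n : nat) (A : 'M[R[i]]_n) :
  \sum_(l <- eigenvalues A) l = \tr A.
Proof.
case: n A => [|n] A.
  by rewrite (size0nil (size_eigenvalues _ A)) big_nil [\tr A]big_ord0.
apply: oppr_inj; rewrite -char_poly_trace // char_poly_eigenvalues.
by rewrite -coefPn_prod_XsubC size_eigenvalues.
Qed.

Lemma spectral_norm_le (n : nat) (A : 'M[R[i]]_n) (M : R) :
  0 <= M -> (forall i, \sum_j normc (A i j) <= M) ->
  (forall j, \sum_i normc (A i j) <= M) -> spectral_norm A <= M.
Proof.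
move=> M0 rowA colA; rewrite -(ger0_norm M0) -sqrtr_sqr ler_wsqrtr //.
rewrite big_seq; apply: bigmax_le => [|l]; first exact: sqr_ge0.
rewrite mem_eigenvalues => eig_l.
(* The comparison moves to [R[i]], where the real part of [l] is at most its modulus. *)
rewrite -lecR rmorphXn /=.
apply: le_trans (norm_eigenvalue_le _ _ _ _ _ _ _ _ eig_l).
- by apply: le_trans (normc_ge_Re l); rewrite lecR ler_norm.
- by rewrite ler0c.
- by move=> i; rewrite -rmorph_sum lecR.
- by move=> j; rewrite -rmorph_sum lecR.
Qed.

Lemma frobenius_le_spectral_norm (n : nat) (A : 'M[R[i]]_n) :
  \sum_i \sum_j normc (A i j) ^+ 2 <= n%:R * spectral_norm A ^+ 2.
Proof.
have max_ge0 : 0 <= \big[Num.max/0]_(l <- eigenvalues (A ^t* *m A)) complex.Re l.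
  by elim/big_rec: _ => // l x _ x0; rewrite le_max x0 orbT.
rewrite sqr_sqrtr //.
have -> : \sum_i \sum_j normc (A i j) ^+ 2
    = \sum_(l <- eigenvalues (A ^t* *m A)) complex.Re l.
  rewrite -(raddf_sum (@complex.Re R)) sum_eigenvalues exchange_big /=.
  rewrite raddf_sum; apply: eq_bigr => j _.
  rewrite mxE raddf_sum; apply: eq_bigr => i _.
  by rewrite !mxE -normCKC -rmorphXn.
apply: (@le_trans _ _ (\sum_(l <- eigenvalues (A ^t* *m A))
   \big[Num.max/0]_(l <- eigenvalues (A ^t* *m A)) complex.Re l)).
  rewrite big_seq [leRHS]big_seq; apply: ler_sum => l l_in.
  exact: le_bigmax_seq.
by rewrite big_const_seq count_predT iter_addr_0 size_eigenvalues mulr_natl.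
Qed.

End SpectralNorm.

Section Circulant.
Variables (R : realType) (n : nat) (r : R[i]) (c : nat -> R).
Let C := circ n.+1 r (fun j => (c j)%:C).

(** Subtraction in ['I_n.+1] is modulo [n.+1], so the two index formulas of [circ] merge into one
    and only the weight, 1 or [r], depends on the case. *)
Lemma circE (i j : 'I_n.+1) :
  C i j = (if (i <= j)%N then 1 else r) * (c (j - i)%R)%:C.
Proof.
rewrite mxE /= modnDmr; case: leqP => ij.
  rewrite mul1r addnBA ?(ltnW (ltn_ord i)) // addnC -addnBA // modnDl modn_small //.
  exact: leq_ltn_trans (leq_subr _ _) (ltn_ord j).
rewrite addnBA ?(ltnW (ltn_ord i)) // [(j + _)%N]addnC modn_small //.
rewrite ltn_subLR; first by rewrite [(i + _)%N]addnC ltn_add2l.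
exact: leq_trans (ltnW (ltn_ord i)) (leq_addr _ _).
Qed.

Hypothesis c_ge0 : forall j, 0 <= c j.

Lemma normc_circ (i j : 'I_n.+1) :
  normc (C i j) = (if (i <= j)%N then 1 else normc r) * c (j - i)%R.
Proof.
rewrite circE ComplexField.Normc.normcM; congr (_ * _).
  by case: leqP; rewrite ?ComplexField.Normc.normc1.
by rewrite /= expr0n addr0 sqrtr_sqr ger0_norm.
Qed.

(** Translation by [i] permutes the residues modulo [n.+1]; for columns, the involution sending [h]
    to [j - h] does the same. *)
Lemma sum_row_shift (f : nat -> R) (i : 'I_n.+1) :
  \sum_(j < n.+1) f (j - i)%R = \sum_(h < n.+1) f h.
Proof.
rewrite (reindex (fun h => h + i)); last first.
  by exists (fun h => h - i) => h _; rewrite ?addrK ?subrK.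
by apply: eq_bigr => h _; rewrite addrK.
Qed.

Lemma sum_col_shift (f : nat -> R) (j : 'I_n.+1) :
  \sum_(i < n.+1) f (j - i)%R = \sum_(h < n.+1) f h.
Proof.
rewrite (reindex (fun h => j - h)); last first.
  by exists (fun h => j - h) => h _; rewrite subKr.
by apply: eq_bigr => h _; rewrite subKr.
Qed.

(** [M] stands for max(1, |r|), so that both cases of the theorem are covered at once; [m] below
    likewise stands for min(1, |r|). *)
Lemma spectral_norm_circ_le (M : R) :
  1 <= M -> normc r <= M -> spectral_norm C <= M * \sum_(h < n.+1) c h.
Proof.
move=> M1 Mr.
have M0 : 0 <= M by apply: le_trans M1.
have entry i j : normc (C i j) <= M * c (j - i)%R.
  by rewrite normc_circ ler_wpM2r //; case: ifP.
apply: spectral_norm_le => [|i|j].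
- by rewrite mulr_ge0 ?sumr_ge0.
- rewrite -(sum_row_shift c i) mulr_sumr; exact: ler_sum.
- rewrite -(sum_col_shift c j) mulr_sumr; exact: ler_sum.
Qed.

Lemma spectral_norm_circ_ge (m : R) :
  0 <= m -> m <= 1 -> m <= normc r ->
  m / Num.sqrt n.+1%:R * \sum_(h < n.+1) c h <= spectral_norm C.
Proof.
move=> m0 m1 mr.
have sum_ge0 : 0 <= \sum_(h < n.+1) c h by rewrite sumr_ge0.
have norm_ge0 : 0 <= spectral_norm C by rewrite sqrtr_ge0.
have n_gt0 : 0 < n.+1%:R :> R by rewrite ltr0n.
rewrite -ler_sqr ?nnegrE ?mulr_ge0 ?invr_ge0 ?sqrtr_ge0 //.
rewrite !exprMn exprVn sqr_sqrtr ?(ltW n_gt0) //.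
(* Each of the [n.+1] rows contributes at least [m ^+ 2] times the sum of the squares of the
   [c h]. *)
have frob : n.+1%:R * (m ^+ 2 * \sum_(h < n.+1) c h ^+ 2)
    <= n.+1%:R * spectral_norm C ^+ 2.
  apply: le_trans (frobenius_le_spectral_norm _ _ C).
  have -> x : n.+1%:R * x = \sum_(i < n.+1) x :> R.
    by rewrite sumr_const card_ord mulr_natl.
  apply: ler_sum => i _.
  have <- := sum_row_shift (fun h => c h ^+ 2) i; rewrite mulr_sumr.
  apply: ler_sum => j _; rewrite -exprMn normc_circ.
  have entry_le : m * c (j - i)%R
      <= (if (i <= j)%N then 1 else normc r) * c (j - i)%R.
    by rewrite ler_wpM2r //; case: ifP.
  have lhs_ge0 : 0 <= m * c (j - i)%R by rewrite mulr_ge0.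
  by rewrite ler_sqr // nnegrE (le_trans lhs_ge0).
rewrite ler_pM2l // in frob; apply: le_trans frob.
rewrite -mulrA ler_wpM2l ?exprn_ge0 // mulrC ler_pdivrMr // mulrC.
exact: sqr_sum_le.
Qed.

End Circulant.

Lemma hyperfib_ge0 (R : realType) (m n : nat) : 0 <= hyperfib R m n.
Proof.
elim: m n => [|m IHm] n /=; first by rewrite invr_ge0 ler0n.
by rewrite sumr_ge0.
Qed.

(** The added term at [h = 0] is an empty sum. *)
Lemma hyperfib_sum (R : realType) (k n : nat) : (0 < k)%N ->
  hyperfib R k.+1 n = \sum_(h < n.+1) hyperfib R k h.
Proof.
case: k => // k _.
rewrite -(big_mkord xpredT (fun h => hyperfib R k.+1 h)) big_ltn //.
by rewrite [X in X + _]big_geq // add0r.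
Qed.

Theorem theorem3p8 (R : realType) (n k : nat) (r : R[i])
    (hn : (1 <= n)%N) (hk : (1 <= k)%N) :
  let C := circ n r (fun j => (hyperfib R k j)%:C) in
  (1 <= ComplexField.Normc.normc r ->
     (Num.sqrt n%:R)^-1 * hyperfib R k.+1 n.-1 <= spectral_norm C /\
     spectral_norm C <=
       ComplexField.Normc.normc r * Num.sqrt (n.-1)%:R * hyperfib R k.+1 n.-1)
  /\
  (ComplexField.Normc.normc r < 1 ->
     ComplexField.Normc.normc r / Num.sqrt n%:R * hyperfib R k.+1 n.-1
       <= spectral_norm C /\
     spectral_norm C <= Num.sqrt (n.-1)%:R * hyperfib R k.+1 n.-1).
Proof.
case: n hn => // n _ C.
have hyp_ge0 j : 0 <= hyperfib R k j by exact: hyperfib_ge0.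
have r_ge0 : 0 <= normc r by rewrite -ler0c; exact: (normr_ge0 r).
(* Here [n] is the matrix size minus one. The square root is at least 1 unless [n = 0], when both
   sides vanish. *)
have S_le : hyperfib R k.+1 n <= Num.sqrt n%:R * hyperfib R k.+1 n.
  case: (posnP n) => [->|n_gt0].
    by rewrite /= big_geq // mulr0.
  rewrite ler_peMl ?hyperfib_ge0 //.
  by rewrite -[leLHS]sqrtr1 ler_wsqrtr // ler1n.
have upper M : 1 <= M -> normc r <= M ->
    spectral_norm C <= M * (Num.sqrt n%:R * hyperfib R k.+1 n).
  move=> M1 Mr.
  apply: le_trans (spectral_norm_circ_le _ _ _ _ hyp_ge0 _ M1 Mr) _.
  by rewrite -hyperfib_sum // ler_wpM2l // (le_trans _ M1).
have lower m : 0 <= m -> m <= 1 -> m <= normc r ->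
    m / Num.sqrt n.+1%:R * hyperfib R k.+1 n <= spectral_norm C.
  by rewrite hyperfib_sum //; exact: spectral_norm_circ_ge.
(* For |r| >= 1 take [m = 1] and [M = |r|]; for |r| < 1 take [m = |r|] and [M = 1]. *)
split=> hr /=; split.
- by rewrite -[_^-1]mul1r lower.
- by rewrite -mulrA upper.
- by rewrite lower // ltW.
- by rewrite -[X in _ <= X]mul1r upper // ltW.
Qed.
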